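(* Let $0\le k_-<k_+<\infty$, let $L\in\mathbb{N}$, and let $\Gamma_L=\{x_1,\dots,x_L\}\subset\mathbb{R}^3$ be a set of $L$ distinct points (sensors), no four of which are coplanar. Consider point-source configurations in $\mathbb{R}^3$ consisting of $M\ge 1$ sources at distinct positions $z_1,\dots,z_M\in\mathbb{R}^3\setminus\Gamma_L$ with scattering strengths $\tau_1,\dots,\tau_M\in\mathbb{C}\setminus\{0\}$, where $L\ge 6M-2$. Then the number $M$, the positions $z_1,\dots,z_M$ and the scattering strengths $\tau_1,\dots,\tau_M$ are uniquely determined by the scattered fields $u^s(x,k)$ for all $x\in\Gamma_L$ and all $k\in(k_-,k_+)$. That is: if $(M;z_1,\dots,z_M;\tau_1,\dots,\tau_M)$ and $(M';z_1',\dots,z_{M'}';\tau_1',\dots,\tau_{M'}')$ are two such configurations (so $L\ge 6M-2$ and $L\ge 6M'-2$) whose scattered fields coincide at all $x\in\Gamma_L$ and all $k\in(k_-,k_+)$, then $M=M'$ and there is a permutation $\sigma$ of $\{1,\dots,M\}$ with $z_m'=z_{\sigma(m)}$ and $\tau_m'=\tau_{\sigma(m)}$ for all $m$.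
   Context: For wave number $k>0$, the scattered field in $\mathbb{R}^3$ of a configuration of $M$ point sources at positions $z_m$ with strengths $\tau_m$ is $$u^s(x,k)=\sum_{m=1}^M\tau_m\Phi_k(x,z_m),\quad x\in\mathbb{R}^3\setminus\{z_1,\dots,z_M\},\qquad \Phi_k(x,y)=\frac{1}{8\pi k^2|x-y|}\left(e^{ik|x-y|}-e^{-k|x-y|}\right),\quad x\neq y.$$ This $u^s$ is the solution of the biharmonic wave equation $\Delta^2u^s-k^4u^s=\sum_{m=1}^M\tau_m\delta_{z_m}$ in $\mathbb{R}^3$, with $\delta_{z}$ the Dirac measure at $z$, satisfying the radiation condition $\partial_r w-ikw=o(r^{-1})$ as $r=|x|\to\infty$ for $w=u^s$ and $w=\Delta u^s$. *)

(* Defs.v *)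
From mathcomp Require Import all_boot all_order all_algebra all_fingroup.
From mathcomp Require Import reals sequences trigo complex.

Set Implicit Arguments.
Unset Strict Implicit.
Unset Printing Implicit Defensive.

Import Order.TTheory GRing.Theory Num.Theory.
Local Open Scope ring_scope.
Local Open Scope complex_scope.

Section ScatteredField.
Variable R : realType.

Definition cexp (z : R[i]) : R[i] :=
  (expR (complex.Re z))%:C * (cos (complex.Im z) +i* sin (complex.Im z)).

Definition dot (u v : 'rV[R]_3) : R := \sum_i u 0 i * v 0 i.

(* The normed-module structure that MathComp-Analysis puts on matrices is the
   sup norm, so the Euclidean distance is defined here. *)
Definition edist (x y : 'rV[R]_3) : R := Num.sqrt (dot (x - y) (x - y)).

(* The points p i all lie in one affine plane {q | n . q = d}; for fewer than
   four points this always holds. *)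
Definition coplanar (I : Type) (p : I -> 'rV[R]_3) : Prop :=
  exists (n : 'rV[R]_3) (d : R), n != 0 /\ forall i, dot n (p i) = d.

Definition no_four_coplanar (L : nat) (x : 'I_L -> 'rV[R]_3) : Prop :=
  forall f : 'I_4 -> 'I_L, injective f -> ~ coplanar (x \o f).

(* Outgoing fundamental solution of the biharmonic wave operator Delta^2 - k^4;
   meaningful for k > 0 and x != y; since 0^-1 = 0, it vanishes at k = 0 or x = y. *)
Definition Phi (k : R) (x y : 'rV[R]_3) : R[i] :=
  let r := edist x y in
  ((8 * pi * k ^+ 2 * r)^-1)%:C * (cexp (0 +i* (k * r)) - cexp ((- (k * r))%:C)).

Definition scattered_field (M : nat) (z : 'I_M -> 'rV[R]_3)
    (tau : 'I_M -> R[i]) (x : 'rV[R]_3) (k : R) : R[i] :=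
  \sum_m tau m * Phi k x (z m).

(* The sources z carry the strengths tau; x lists the sensors. *)
Definition admissible (L : nat) (x : 'I_L -> 'rV[R]_3) (M : nat)
    (z : 'I_M -> 'rV[R]_3) (tau : 'I_M -> R[i]) : Prop :=
  [/\ (1 <= M)%N, (6 * M - 2 <= L)%N, injective z,
      forall m l, z m != x l & forall m, tau m != 0].

End ScatteredField.

(* Main.v *)
(* Sampled along an arithmetic progression of wave numbers with a small step, the
   difference of the two fields at a sensor x is a combination of powers of the
   distinct numbers e^(ihr) and e^(-hr), r ranging over the distances from x to
   the sources.  By Vandermonde, for each r the (signed) strengths at distance r
   from x sum to 0.  If the net strength at some point p were nonzero, every
   sensor would therefore be equidistant from p and from another source.  There
   are at most M + M' - 1 such bisector planes, each containing at most three
   sensors, so L <= 3 (M + M' - 1) <= 6 max(M, M') - 3, a contradiction.  Hence the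
   two configurations agree point by point. *)
Require Import Defs.
From mathcomp Require Import all_boot all_order all_algebra all_fingroup.
From mathcomp Require Import reals complex.
From mathcomp Require Import sequences exp trigo ring lra zify.

Set Implicit Arguments.
Unset Strict Implicit.
Unset Printing Implicit Defensive.

Import Order.TTheory GRing.Theory Num.Theory.
Local Open Scope ring_scope.

Local Open Scope complex_scope.

(** * Vandermonde elimination in power sums *)

Lemma sum_horner_eq0 (F : fieldType) (I : finType) (c w : I -> F) (n : nat) :
  (forall j : nat, (j < n)%N -> \sum_i c i * w i ^+ j = 0) ->
  forall p : {poly F}, (size p <= n)%N -> \sum_i c i * p.[w i] = 0.
Proof.
move=> cw0 p szp.
under eq_bigr => i _ do rewrite (horner_coef_wide _ szp) mulr_sumr.
rewrite exchange_big big1 //= => j _.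
under eq_bigr => i _ do rewrite mulrCA.
by rewrite -mulr_sumr cw0 // mulr0.
Qed.

(* Vandermonde, with the terms sharing a node grouped together. *)
Lemma power_sums_fiber_eq0 (F : fieldType) (I : finType) (c w : I -> F) :
  (forall j : nat, (j <= #|I|)%N -> \sum_i c i * w i ^+ j = 0) ->
  forall w0 : F, \sum_(i | w i == w0) c i = 0.
Proof.
(* [p] vanishes at every node except [w0]. Its degree can reach [#|I|], which is why the exponent
   [#|I|] is included in the hypothesis. *)
move=> cw0 w0; pose p := \prod_(i <- enum [pred i | w i != w0]) ('X - (w i)%:P).
have szp : (size p <= #|I|.+1)%N by rewrite size_prod_XsubC -cardE ltnS max_card.
have pE a : p.[a] = \prod_(i | w i != w0) (a - w i).
  by rewrite horner_prod big_enum; apply: eq_bigr => i _; rewrite hornerXsubC.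
have pw0 : p.[w0] != 0 by rewrite pE; apply/prodf_neq0 => i wi; rewrite subr_eq0 eq_sym.
have pw i : w i != w0 -> p.[w i] = 0.
  by move=> wi; rewrite pE (bigD1 i) //= subrr mul0r.
have /eqP := @sum_horner_eq0 _ _ c w #|I|.+1 cw0 p szp.
rewrite (bigID (fun i => w i == w0)) /= [X in _ + X]big1 ?addr0; last first.
  by move=> i /pw ->; rewrite mulr0.
under eq_bigr => i /eqP -> do [].
by rewrite -mulr_suml mulf_eq0 (negPf pw0) orbF => /eqP.
Qed.

(** * Exponential waves and their sampling in the wave number *)

Lemma cexpD (R : realType) (a b : R[i]) : cexp (a + b) = cexp a * cexp b.
Proof.
case: a b => [a a'] [b b']; rewrite /cexp /= expRD cosD sinD; simpc.
by apply/eqP; rewrite eq_complex /=; apply/andP; split; apply/eqP; ring.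
Qed.

Lemma cexp0 (R : realType) : cexp (0 : R[i]) = 1.
Proof. by rewrite /cexp /= expR0 cos0 sin0; simpc. Qed.

Lemma cexp_neq0 (R : realType) (a : R[i]) : cexp a != 0.
Proof.
by apply/eqP => a0; have := cexpD a (- a);
  rewrite a0 mul0r subrr cexp0 => /eqP; rewrite oner_eq0.
Qed.

Lemma cexpMn (R : realType) (a : R[i]) (n : nat) : cexp (a *+ n) = cexp a ^+ n.
Proof.
elim: n => [|n IHn]; first by rewrite mulr0n expr0 cexp0.
by rewrite mulrS exprS cexpD IHn.
Qed.

(** The exponents of the oscillating and evanescent parts of [Phi], indexed by a boolean so that all
    waves form one family over [bool * I]. *)
Definition wave_exponent (R : realType) (b : bool) (r : R) : R[i] :=
  if b then 0 +i* r else (- r)%:C.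

Lemma wave_exponentD (R : realType) (b : bool) (r s : R) :
  wave_exponent b (r + s) = wave_exponent b r + wave_exponent b s.
Proof. by case: b; rewrite /wave_exponent; simpc; rewrite ?opprD. Qed.

Lemma wave_exponentMn (R : realType) (b : bool) (r : R) (n : nat) :
  wave_exponent b (r *+ n) = wave_exponent b r *+ n.
Proof.
elim: n => [|n IHn]; last by rewrite !mulrS wave_exponentD IHn.
by case: b; rewrite /wave_exponent; simpc; rewrite ?oppr0.
Qed.

Lemma cexp_oscillating (R : realType) (r : R) :
  cexp (wave_exponent true r) = cos r +i* sin r.
Proof. by rewrite /cexp /= expR0; simpc. Qed.

Lemma cexp_evanescent (R : realType) (r : R) :
  cexp (wave_exponent false r) = (expR (- r))%:C.
Proof. by rewrite /cexp /= cos0 sin0; simpc. Qed.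

(* On ]0, pi[ the node e^(ir) is not real and cos is injective. *)
Lemma cexp_wave_exponent_eq (R : realType) (b : bool) (r s : R) :
  0 < r < pi -> 0 < s < pi ->
  (cexp (wave_exponent b r) == cexp (wave_exponent true s)) = b && (r == s).
Proof.
move=> /andP[r0 rpi] /andP[s0 spi]; have sin0 := sin_gt0_pi (introT andP (conj s0 spi)).
apply/eqP/andP => [|[-> /eqP ->] //]; rewrite cexp_oscillating.
case: b => [|]; first rewrite cexp_oscillating => -[crs _].
  by split=> //; apply/eqP/(@cos_inj R); rewrite // in_itv /= ?(ltW r0) ?(ltW s0) /= ltW.
by rewrite cexp_evanescent => -[_ E]; move: sin0; rewrite -E ltxx.
Qed.

(** With [S] bounding the distances, [h * S < pi] keeps the phases in the range where nodes are
    separated; [h *+ n < d] keeps all samples inside the wave number interval. *)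
Lemma exists_small_step (R : realType) (S d : R) (n : nat) :
  0 <= S -> 0 < d -> exists h : R, [/\ 0 < h, h * S < pi & h *+ n < d].
Proof.
move=> S0 d0; have S1 : 0 < S + 1 by rewrite ltr_wpDl.
have n1 : 0 < n%:R + 1 :> R by rewrite ltr_wpDl.
have p0 := pi_gt0 R; exists (Num.min (pi / (S + 1)) (d / (n%:R + 1))).
set h := Num.min _ _.
have h0 : 0 < h by rewrite lt_min !divr_gt0.
have h1 : h * (S + 1) <= pi by rewrite -ler_pdivlMr // /h ge_min lexx.
have h2 : h * (n%:R + 1) <= d by rewrite -ler_pdivlMr // /h ge_min lexx orbT.
split=> //; first by apply: lt_le_trans h1; rewrite ltr_pM2l // ltrDl.
by apply: lt_le_trans h2; rewrite -[h *+ n]mulr_natr ltr_pM2l // ltrDl.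
Qed.

Lemma field_eq0_strength_sums (R : realType) (kmin kmax : R) (I : finType)
    (P : I -> 'rV[R]_3) (c : I -> R[i]) (x : 'rV[R]_3) :
  0 <= kmin -> kmin < kmax -> (forall i, 0 < edist x (P i)) ->
  (forall k, kmin < k < kmax -> \sum_i c i * Phi k x (P i) = 0) ->
  forall r : R, \sum_(i | edist x (P i) == r) c i = 0.
Proof.
move=> kmin0 kminmax d_gt0 u0 r.
have [i0 /eqP <-|none] := pickP (fun i => edist x (P i) == r); last first.
  by rewrite big_pred0.
(* Sampling starts at the midpoint [k0]; the sum of the distances serves as a bound on each of
   them. *)
pose d i := edist x (P i); pose k0 := (kmin + kmax) / 2.
have S0 : 0 <= \sum_i d i by apply: sumr_ge0 => i _; apply: ltW (d_gt0 i).
have k0max : 0 < kmax - k0 by rewrite /k0; lra.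
have [h [h0 hS hn]] := exists_small_step #|{: bool * I}| S0 k0max.
have hd i : 0 < h * d i < pi.
  rewrite mulr_gt0 ?d_gt0 //=; apply: le_lt_trans hS; rewrite ler_pM2l // (bigD1 i) //=.
  by rewrite lerDl sumr_ge0 // => j _; apply: ltW (d_gt0 j).
pose sgn (b : bool) : R[i] := if b then 1 else -1.
pose C (p : bool * I) := sgn p.1 * (c p.2 / (d p.2)%:C)
  * cexp (wave_exponent p.1 (k0 * d p.2)).
pose w (p : bool * I) := cexp (wave_exponent p.1 (h * d p.2)).
have Cw j : (j <= #|{: bool * I}|)%N -> \sum_p C p * w p ^+ j = 0.
  move=> jn; pose k := k0 + h *+ j.
  have kint : kmin < k < kmax.
    have hj : h *+ j <= h *+ #|{: bool * I}| by rewrite ler_pMn2l.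
    have hj0 : 0 <= h *+ j by rewrite mulrn_wge0 // ltW.
    by move: hn hj hj0; rewrite /k /k0; lra.
  have k_neq0 : k != 0.
    by apply: lt0r_neq0; case/andP: kint => kmink _; apply: le_lt_trans kmink.
  (* The factor [k ^- 2] of [Phi] is not geometric in [j], so it is cleared first; this is possible
     because [k > 0]. *)
  transitivity ((8 * pi * k ^+ 2)%:C * \sum_i c i * Phi k x (P i)); last first.
    by rewrite u0 // mulr0.
  have term p : C p * w p ^+ j
      = sgn p.1 * (c p.2 / (d p.2)%:C) * cexp (wave_exponent p.1 (k * d p.2)).
    by rewrite /C /w -cexpMn -mulrA -cexpD -wave_exponentMn -wave_exponentD
      -mulrnAl -mulrDl.
  under eq_bigr => p _ do rewrite term.
  rewrite -(pair_bigA _ (fun b i => sgn b * (c i / (d i)%:C)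
    * cexp (wave_exponent b (k * d i)))) exchange_big mulr_sumr /=.
  apply: eq_bigr => i _; rewrite big_bool /= /Phi -/(d i).
  rewrite /wave_exponent; set a := cexp _; set b := cexp _.
  have -> : ((8 * pi * k ^+ 2 * d i)^-1)%:C
      = ((8 * pi * k ^+ 2)%:C)^-1 * ((d i)%:C)^-1 :> R[i].
    by rewrite -fmorphV -fmorphV -rmorphM -invfM.
  have D0 : (8 * pi * k ^+ 2)%:C != 0 :> R[i].
    by rewrite fmorph_eq0 !mulf_neq0 // ?expf_neq0 // ?pnatr_eq0 // gt_eqF // pi_gt0.
  have d0 : (d i)%:C != 0 :> R[i] by rewrite fmorph_eq0 gt_eqF // d_gt0.
  by move: (_%:C) (_%:C) D0 d0 => D e D0 d0; field; apply/andP.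
have := power_sums_fiber_eq0 Cw (cexp (wave_exponent true (h * d i0))).
under eq_bigl => p do rewrite cexp_wave_exponent_eq // (inj_eq (mulfI (lt0r_neq0 h0))).
rewrite -(pair_big (fun b => b) (fun i => d i == d i0) (fun b i => C (b, i))) /=.
rewrite (big_pred1 true) => [|[] //].
(* Only oscillating terms at distance [d i0] remain; they share the nonzero factor made of the
   inverse distance and the phase at [k0]. *)
under eq_bigr => i /eqP di do rewrite /C /= di mul1r -mulrA.
rewrite -mulr_suml => /eqP; rewrite mulf_eq0 mulf_eq0 invr_eq0 fmorph_eq0.
by rewrite (gt_eqF (d_gt0 _)) (negPf (cexp_neq0 _)) !orbF => /eqP.
Qed.

(** * Bisector planes and the counting of sensors *)

Lemma dot_self_ge0 (R : realType) (v : 'rV[R]_3) : 0 <= dot v v.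
Proof. by apply: sumr_ge0 => i _; apply: sqr_ge0. Qed.

Lemma edist_gt0 (R : realType) (x y : 'rV[R]_3) : x != y -> 0 < edist x y.
Proof.
move=> xy; rewrite sqrtr_gt0 lt_neqAle dot_self_ge0 andbT eq_sym.
apply: contra xy; rewrite psumr_eq0 => [/allP v0|i _]; last exact: sqr_ge0.
apply/eqP/rowP => i; have := v0 i (mem_index_enum _).
by rewrite /= mulf_eq0 orbb !mxE subr_eq0 => /eqP.
Qed.

(** The quadratic terms in [x j] cancel between the squared distances, leaving the equation of the
    bisector plane, with normal [q - p]. *)
Lemma equidistant_coplanar (R : realType) (J : Type) (x : J -> 'rV[R]_3)
    (p q : 'rV[R]_3) :
  p != q -> (forall j, edist (x j) p = edist (x j) q) -> coplanar x.
Proof.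
move=> pq eqd; exists (q - p), ((dot q q - dot p p) / 2).
split=> [|j]; first by rewrite subr_eq0 eq_sym.
have := congr1 (fun s => s ^+ 2) (eqd j); rewrite /edist !sqr_sqrtr ?dot_self_ge0 //.
rewrite /dot !big_ord_recl !big_ord0 !mxE => E.
by lra.
Qed.

Lemma card_equidistant_sensors (R : realType) (L : nat) (x : 'I_L -> 'rV[R]_3)
    (p q : 'rV[R]_3) :
  no_four_coplanar x -> p != q ->
  (#|[set l | edist (x l) p == edist (x l) q]| <= 3)%N.
Proof.
move=> x4 pq; rewrite leqNgt; apply/negP => A4; set A := [set _ | _] in A4.
apply: (x4 (fun j => enum_val (widen_ord A4 j))).
  by move=> i j /enum_val_inj/(congr1 val)/= ?; apply: val_inj.
apply: (equidistant_coplanar pq) => j /=.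
by have := enum_valP (widen_ord A4 j); rewrite inE => /eqP.
Qed.

Lemma strength_at_point_eq0 (R : realType) (L : nat) (x : 'I_L -> 'rV[R]_3)
    (I : finType) (P : I -> 'rV[R]_3) (c : I -> R[i]) :
  no_four_coplanar x -> (3 * #|I|.-1 < L)%N ->
  (forall l r, \sum_(i | edist (x l) (P i) == r) c i = 0) ->
  forall p, \sum_(i | P i == p) c i = 0.
Proof.
move=> x4 IL c0 p; apply/eqP/negPn/negP => cp.
have [i0 /eqP Pi0|none] := pickP (fun i => P i == p); last first.
  by rewrite big_pred0 ?eqxx in cp.
pose A i := [set l | edist (x l) p == edist (x l) (P i)].
have cover l : (1 <= \sum_(i | P i != p) (l \in A i))%N.
  have [i /andP[Pi li]|none] :=
    pickP (fun i => (P i != p) && (edist (x l) p == edist (x l) (P i))).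
    by rewrite (bigD1 i) //= inE li.
  (* If no point other than [p] is as far from sensor [l] as [p] is, the sum over that distance is
     exactly the net strength at [p]. *)
  case/negP: cp; rewrite -[X in _ == X](c0 l (edist (x l) p)); apply/eqP/eq_bigl => i.
  have := none i; have [->|_ /=] := eqVneq (P i) p; first by rewrite eqxx.
  by rewrite eq_sym.
(* Double counting of the pairs of a sensor and a bisector plane containing it. *)
have : (L <= \sum_(i | P i != p) #|A i|)%N.
  rewrite -[L in (L <= _)%N]card_ord -sum1_card.
  under [X in (_ <= X)%N]eq_bigr => i _ do rewrite -sum1_card big_mkcond.
  rewrite exchange_big leq_sum // => l _; apply: leq_trans (cover l) _.
  by apply: leq_sum => i _; case: (l \in A i).
apply/negP; rewrite -ltnNge; apply: leq_ltn_trans IL.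
apply: (@leq_trans (\sum_(i | P i != p) 3)%N).
  by apply: leq_sum => i Pi; apply: card_equidistant_sensors; rewrite // eq_sym.
(* The index [i0] sits at [p] and gives no plane, hence the predecessor in [3 * #|I|.-1]. *)
rewrite sum_nat_const mulnC leq_mul2l /= -(cardC1 i0).
apply/subset_leq_card/subsetP => i; rewrite !inE.
by apply: contraNneq => ->; rewrite Pi0.
Qed.

(** * Matching the two configurations *)

Lemma same_fields_sub (R : realType) (kmin kmax : R) (L : nat)
    (x : 'I_L -> 'rV[R]_3) (M M' : nat)
    (z : 'I_M -> 'rV[R]_3) (z' : 'I_M' -> 'rV[R]_3)
    (tau : 'I_M -> R[i]) (tau' : 'I_M' -> R[i]) :
  0 <= kmin -> kmin < kmax -> no_four_coplanar x ->
  admissible x z tau -> admissible x z' tau' ->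
  (forall (l : 'I_L) (k : R), kmin < k < kmax ->
     scattered_field z tau (x l) k = scattered_field z' tau' (x l) k) ->
  forall m', exists m, z' m' = z m /\ tau' m' = tau m.
Proof.
move=> kmin0 kminmax x4 [M1 ML zI zx tau0] [M1' ML' zI' zx' tau0'] eqf m'.
(* The difference of the fields is the field of the disjoint union with strengths [tau] and
   [- tau']. At [z' m'] its net strength is [- tau' m'] unless some [z m] coincides with it. *)
pose P (i : 'I_M + 'I_M') := match i with inl m => z m | inr m => z' m end.
pose c (i : 'I_M + 'I_M') := match i with inl m => tau m | inr m => - tau' m end.
(* Here [3 * (M + M' - 1)] is at most [6 * maxn M M' - 3], just below the required number of
   sensors. *)
have ML2 : (3 * #|{: 'I_M + 'I_M'}|.-1 < L)%N by rewrite card_sum !card_ord; lia.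
have sums0 l r : \sum_(i | edist (x l) (P i) == r) c i = 0.
  apply: (field_eq0_strength_sums kmin0 kminmax) => [[m|m]|k kint].
  - by rewrite edist_gt0 // eq_sym zx.
  - by rewrite edist_gt0 // eq_sym zx'.
  rewrite big_sumType /=.
  under [X in _ + X]eq_bigr => i _ do rewrite mulNr.
  by rewrite sumrN; apply/eqP; rewrite subr_eq0; apply/eqP/eqf.
have := strength_at_point_eq0 x4 ML2 sums0 (z' m').
rewrite big_sumType /= [X in _ + X](big_pred1 m') => [|m]; last first.
  by rewrite /= (inj_eq zI').
have [m /eqP zm|none] := pickP (fun m => z m == z' m').
  rewrite (big_pred1 m) => [|n]; last by rewrite /= -zm (inj_eq zI).
  by move/eqP; rewrite subr_eq0 => /eqP tauE; exists m.
by rewrite big_pred0 // add0r => /eqP; rewrite oppr_eq0 (negPf (tau0' _)).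
Qed.

Theorem theorem3p3 (R : realType) (kmin kmax : R) (L : nat)
    (x : 'I_L -> 'rV[R]_3)
    (M M' : nat) (z : 'I_M -> 'rV[R]_3) (z' : 'I_M' -> 'rV[R]_3)
    (tau : 'I_M -> R[i]) (tau' : 'I_M' -> R[i]) :
  0 <= kmin -> kmin < kmax ->
  injective x -> no_four_coplanar x ->
  admissible x z tau -> admissible x z' tau' ->
  (forall (l : 'I_L) (k : R), kmin < k < kmax ->
     scattered_field z tau (x l) k = scattered_field z' tau' (x l) k) ->
  exists (eqM : M = M') (s : 'S_M), forall m : 'I_M,
    z' (cast_ord eqM m) = z (s m) /\ tau' (cast_ord eqM m) = tau (s m).
Proof.
move=> kmin0 kminmax _ x4 adm adm' eqf.
have [_ _ zI _ _] := adm; have [_ _ zI' _ _] := adm'.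
have /fin_all_exists[f fE] := same_fields_sub kmin0 kminmax x4 adm adm' eqf.
have /fin_all_exists[g gE] := same_fields_sub kmin0 kminmax x4 adm' adm
  (fun l k kint => esym (eqf l k kint)).
have fI : injective f.
  by move=> i j fij; apply: zI'; rewrite (fE i).1 (fE j).1 fij.
have gI : injective g.
  by move=> i j gij; apply: zI; rewrite (gE i).1 (gE j).1 gij.
have eqM : M = M'.
  by apply/eqP; rewrite eqn_leq; have := leq_card f fI; have := leq_card g gI;
    rewrite !card_ord => -> ->.
(* Once [M'] is identified with [M], the injection [f] is a self-map of a finite set, hence a
   permutation. *)
exists eqM; case: M' / eqM z' tau' f g {adm' eqf zI' gI gE} fE fI => z' tau' f _ fE fI.
by exists (perm fI) => m; rewrite permE cast_ord_id.
Qed.
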